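(* For every integer $n\geqslant 4$, the monoid $\mathrm{PswEnd}(S_n)$ of all partial strong weak endomorphisms of the star graph $S_n$ has rank $7$.
   Context: For $n\geqslant1$, the star graph $S_n$ is the simple graph with vertex set $\{0,1,\ldots,n-1\}$ and edge set $E=\{\{0,i\}\mid 1\leqslant i\leqslant n-1\}$ (so $n$ vertices). $\mathcal{PT}(V)$ denotes the monoid of all partial transformations (partial maps $V\to V$, including the empty one) of a finite set $V$ under composition; maps are written on the right and composed left to right. For a graph $G=(V,E)$, a map $\alpha\in\mathcal{PT}(V)$ is a partial strong weak endomorphism of $G$ if for all $u,v\in\mathrm{Dom}(\alpha)$: ($\{u,v\}\in E$ and $u\alpha\neq v\alpha$) if and only if $\{u\alpha,v\alpha\}\in E$. $\mathrm{PswEnd}(G)$ is the set of all of them; it is a submonoid of $\mathcal{PT}(V)$. The rank of a finite monoid $M$ is the minimum size of a generating set of $M$ (as a monoid). *)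

(* Defs.v *)
From HB Require Import structures.
From mathcomp Require Import all_boot.

Set Implicit Arguments.
Unset Strict Implicit.
Unset Printing Implicit Defensive.

Local Open Scope group_scope.

#[short(type="finMonoidType")]
HB.structure Definition FinMonoid := {T of Monoid T & Finite T}.

Section Rank.

Variable T : finMonoidType.
Implicit Types A M N : {set T}.

Definition submonoid N : bool :=
  (1 \in N) && [forall x in N, forall y in N, x * y \in N].

Lemma submonoidP N : reflect (monoid_closed N) (submonoid N).
Proof.
apply: (iffP andP) => -[N1 NM]; split=> //.
  by move=> x y Nx Ny; move/'forall_in_'forall_in_idP: NM; apply.
by apply/'forall_in_'forall_in_idP => x Nx y Ny; apply: NM.
Qed.

Definition monoid_gen A : {set T} :=
  \bigcap_(N : {set T} | submonoid N && (A \subset N)) N.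

(* The default value M of the arg min is itself a generating set as soon as M
   is a submonoid; no meaning is intended for other M. *)
Definition monoid_rank M : nat :=
  #|[arg min_(A < M | monoid_gen A == M) #|A|]|.

Lemma monoid_gen_id M : submonoid M -> monoid_gen M = M.
Proof.
move=> sM; apply/eqP; rewrite eqEsubset; apply/andP; split.
  by apply: bigcap_inf; rewrite sM subxx.
by apply/bigcapsP => N /andP[].
Qed.

Lemma monoid_rankP M r : submonoid M ->
  monoid_rank M = r <->
  (exists2 A, monoid_gen A = M & #|A| = r) /\
  (forall A, monoid_gen A = M -> r <= #|A|).
Proof.
move=> /monoid_gen_id/eqP gM; rewrite /monoid_rank.
case: arg_minnP => // B /eqP gB minB; split=> [<-|[[A gA <-] minA]].
  by split=> [|A /eqP/minB //]; exists B.
by apply/eqP; rewrite eqn_leq minA // minB ?gA.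
Qed.

End Rank.

(* Partial maps V -> V; [a u = None] means that u is not in Dom(a). *)
Definition ptransf (V : finType) : Type := {ffun V -> option V}.

HB.instance Definition _ (V : finType) := Finite.on (ptransf V).

Section PartialTransformations.

Variable V : finType.
Implicit Types a b c : ptransf V.

Definition ptransf_one : ptransf V := [ffun u => Some u].

(* Maps act on the right: [a * b] applies a first. *)
Definition ptransf_mul a b : ptransf V := [ffun u => obind b (a u)].

Lemma ptransf_mulA : associative ptransf_mul.
Proof.
move=> a b c; apply/ffunP => u; rewrite !ffunE.
by case: (a u) => //= x; rewrite ffunE.
Qed.

Lemma ptransf_mul1 : left_id ptransf_one ptransf_mul.
Proof. by move=> a; apply/ffunP => u; rewrite !ffunE. Qed.

Lemma ptransf_mulr1 : right_id ptransf_one ptransf_mul.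
Proof.
by move=> a; apply/ffunP => u; rewrite ffunE; case: (a u) => //= x; rewrite ffunE.
Qed.

End PartialTransformations.

HB.instance Definition _ (V : finType) :=
  isMonoid.Build (ptransf V)
    (@ptransf_mulA V) (@ptransf_mul1 V) (@ptransf_mulr1 V).

Lemma ptransf1E (V : finType) (u : V) : (1 : ptransf V) u = Some u.
Proof. exact: ffunE. Qed.

Lemma ptransfME (V : finType) (a b : ptransf V) u : (a * b) u = obind b (a u).
Proof. exact: ffunE. Qed.

Record sgraph (V : finType) := SGraph {
  edge :> rel V;
  edge_sym : symmetric edge;
  edge_irr : irreflexive edge
}.

Section PswEnd.

Variables (V : finType) (G : sgraph V).

Definition psw_endomorphism (a : ptransf V) : bool :=
  [forall u, forall v,
    if (a u, a v) is (Some x, Some y)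
    then (edge G u v && (x != y)) == edge G x y
    else true].

Definition PswEnd : {set ptransf V} := [set a | psw_endomorphism a].

Lemma PswEnd_submonoid : submonoid PswEnd.
Proof.
apply/submonoidP; split=> [|a b].
  rewrite inE; apply/'forall_forallP => u v; rewrite !ptransf1E.
  by have [->|_] := eqVneq u v; rewrite ?edge_irr ?andbF ?andbT eqxx.
rewrite !inE => /'forall_forallP Ha /'forall_forallP Hb.
apply/'forall_forallP => u v; rewrite !ptransfME.
have := Ha u v; case: (a u) => [x|] //=; case: (a v) => [y|] /=; last by case: (b x).
move/eqP=> Hxy; have := Hb x y.
case bx: (b x) => [x'|] //; case by': (b y) => [y'|] //= /eqP <-.
rewrite -Hxy.
have [xy|nxy] := eqVneq x y; last by rewrite !andbT.
by move: bx; rewrite xy by' => -[->]; rewrite eqxx !andbF.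
Qed.

End PswEnd.

Definition star_edge n : rel 'I_n :=
  fun i j => ((i == 0 :> nat) && (0 < j)) || ((j == 0 :> nat) && (0 < i)).

Lemma star_edge_sym n : symmetric (@star_edge n).
Proof. by move=> i j; rewrite /star_edge orbC. Qed.

Lemma star_edge_irr n : irreflexive (@star_edge n).
Proof. by move=> i; rewrite /star_edge orbb; case: (val i). Qed.

Definition star_graph n : sgraph 'I_n :=
  SGraph (@star_edge_sym n) (@star_edge_irr n).

(* Main.v *)
(** The elements of PswEnd(S_n) fixing the centre and mapping leaves to leaves
   form a copy of PT(n-1), generated by a transposition, a long cycle, one
   collapse of two leaves and one partial identity. Adding the partial identity
   off the centre, the map exchanging the centre with the leaves and the constant
   map to the centre gives everything.

   Conversely, a product that is a unit has only unit factors, and the units do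
   not commute, so a generating set contains two units. It also meets each of
   five further classes of elements, because a product lies in such a class only
   if one of its factors does: total maps identifying exactly one pair of
   vertices, injective maps undefined at exactly one leaf, injective maps undefined
   exactly at the centre, maps sending the centre to a leaf and some leaf to the
   centre, and maps sending the centre and some leaf to the same vertex. *)

Require Import Defs.
From mathcomp Require Import all_boot all_fingroup.

Set Implicit Arguments.
Unset Strict Implicit.
Unset Printing Implicit Defensive.

Local Open Scope group_scope.

(** * Generators of the symmetric group *)

(** Conjugating the transposition (0 1) repeatedly by the cycle gives all (k k+1); conjugating (0 k)
    by (k k+1) then gives (0 k+1), and the transpositions moving 0 generate. *)
Lemma perm_gen_tperm_ordS n :
  <<[set tperm ord0 (inord 1); perm (@ordS_inj n.+2)]>> = [set: 'S_n.+2].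
Proof.
set c := perm _; set G := <<_>>.
have Gc : c \in G by rewrite mem_gen // !inE eqxx orbT.
have cE (k : nat) : k.+1 < n.+2 -> c (inord k) = inord k.+1.
  move=> ltk; apply/val_inj; rewrite permE /= !inordK ?modn_small //.
  exact: ltnW.
have Gadj (k : nat) : k.+1 < n.+2 -> tperm (inord k) (inord k.+1) \in G.
  elim: k => [_|k IHk ltk].
    rewrite mem_gen // !inE; apply/orP; left; apply/eqP; congr tperm.
    by apply/val_inj; rewrite /= inordK.
  have ltk' := ltnW ltk.
  by rewrite -(cE k) // -(cE k.+1) // -tpermJ groupJ ?IHk.
have G0 (k : nat) : k < n.+2 -> tperm ord0 (inord k) \in G.
  elim: k => [_|[|k] IHk ltk].
  - by rewrite (_ : inord 0 = ord0) ?tperm1 //; apply/val_inj; rewrite /= inordK.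
  - by rewrite mem_gen // !inE eqxx.
  have := Gadj _ ltk; move/(groupJ (IHk (ltnW ltk))).
  have ne0 (j : nat) : j.+1 < n.+2 -> inord j.+1 != ord0 :> 'I_n.+2.
    by move=> ltj; apply/eqP => /(congr1 val); rewrite /= inordK.
  by rewrite tpermJ tpermL tpermD // ne0 // ltnW.
apply/eqP; rewrite eqEsubset subsetT -(gen_tperm ord0) gen_subG.
by apply/subsetP => _ /imsetP[y _ ->]; rewrite -[y]inord_val G0.
Qed.

(** * Generators of the monoid of all partial transformations *)

Section PartialTransformationMonoid.

Variable V : finType.
Implicit Types (a b : ptransf V) (i j p u v : V) (s : {perm V}).

Definition of_perm s : ptransf V := [ffun u => Some (s u)].

Definition collapse i j : ptransf V :=
  [ffun u => Some (if u == i then j else u)].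

Definition remove i : ptransf V := [ffun u => if u == i then None else Some u].

Definition assign a i p : ptransf V :=
  [ffun u => if u == i then Some p else a u].

Definition ptransf_im a : {set V} := [set p | [exists u, a u == Some p]].

Lemma ptransf_imP a p : reflect (exists u, a u = Some p) (p \in ptransf_im a).
Proof. by rewrite inE; apply: (iffP existsP) => -[u /eqP]; exists u. Qed.

Lemma of_permM s t : of_perm (s * t) = of_perm s * of_perm t.
Proof. by apply/ffunP => u; rewrite ptransfME !ffunE /= ffunE permM. Qed.

Lemma of_perm1 : of_perm 1 = 1.
Proof. by apply/ffunP => u; rewrite ptransf1E ffunE perm1. Qed.

Lemma collapseJ s i j :
  of_perm s * collapse (s i) (s j) * of_perm s^-1 = collapse i j.
Proof.
apply/ffunP => u; rewrite !ptransfME !ffunE /= !ffunE /= !ffunE.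
by rewrite (inj_eq perm_inj); case: eqP => _; rewrite permK.
Qed.

Lemma removeJ s i : of_perm s * remove (s i) * of_perm s^-1 = remove i.
Proof.
apply/ffunP => u; rewrite !ptransfME !ffunE /= !ffunE /=.
by rewrite (inj_eq perm_inj); case: eqP => _ //=; rewrite ffunE permK.
Qed.

Lemma remove_assign a i p : a i = None -> remove i * assign a i p = a.
Proof.
move=> ai; apply/ffunP => u; rewrite ptransfME ffunE.
by case: eqP => [->|/eqP/negPf ne] //=; rewrite ffunE ne.
Qed.

Lemma collapse_assign a i j p :
  i != j -> a i = a j -> collapse i j * assign a i p = a.
Proof.
move=> ne aij; apply/ffunP => u; rewrite ptransfME !ffunE /= ffunE.
by have [->|/negPf->] := eqVneq u i; rewrite // eq_sym (negPf ne).
Qed.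

(** A section of [a] is injective, hence a permutation by finiteness, and [a] is its inverse. *)
Lemma onto_of_perm a : ptransf_im a = setT -> exists s, a = of_perm s.
Proof.
move=> aT; have ontoP p : exists u, a u == Some p.
  by apply/existsP; move/setP/(_ p): aT; rewrite !inE.
pose g p := xchoose (ontoP p).
have gK p : a (g p) = Some p by apply/eqP/(xchooseP (ontoP p)).
have g_inj : injective g by move=> p q /(congr1 a); rewrite !gK => -[].
exists (perm g_inj)^-1; apply/ffunP => u.
by rewrite ffunE -{1}[u](permKV (perm g_inj)) permE gK.
Qed.

Lemma not_onto_reducible a p : p \notin ptransf_im a ->
  (exists i, a i = None) \/ (exists i j, i != j /\ a i = a j).
Proof.
move=> pNa; have [/existsP[i /eqP ai]|/existsPn tot] := boolP [exists i, a i == None].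
  by left; exists i.
right; pose f u := odflt u (a u).
have aE u : a u = Some (f u) by rewrite /f; case: (a u) (tot u).
have [f_inj|/injectivePn[i [j ne fij]]] := boolP (injectiveb f).
  case/ptransf_imP: pNa; have /codomP[u ->] : p \in codom f.
    by apply: injF_onto; apply/injectiveP.
  by exists u.
by exists i, j; rewrite !aE fij.
Qed.

(* Redirecting to a point outside the image a vertex that is undefined, or that
   shares its value with another vertex, enlarges the image; iterating this
   leads to a permutation. *)
Lemma ptransf_gen (N : {set ptransf V}) i0 j0 : submonoid N -> i0 != j0 ->
  (forall s, of_perm s \in N) -> collapse i0 j0 \in N -> remove i0 \in N ->
  N = setT.
Proof.
move=> /submonoidP[_ NM] ne0 Nperm Ncol Nrem.
have NremA i : remove i \in N.
  by rewrite -(removeJ (tperm i i0)) tpermL !NM.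
have NcolA i j : i != j -> collapse i j \in N.
  (* [s] carries [i] to [i0] and [j] to [j0]: its second factor fixes [i0], which differs from both
     [t j] and [j0]. *)
  move=> ne; set t := tperm i i0; pose s := t * tperm (t j) j0.
  have ti : t i = i0 by rewrite tpermL.
  have si : s i = i0.
    by rewrite permM ti tpermD // 1?eq_sym // -ti (inj_eq perm_inj).
  have sj : s j = j0 by rewrite permM tpermL.
  by rewrite -(collapseJ s) si sj !NM.
apply/eqP; rewrite eqEsubset subsetT; apply/subsetP => a _.
have [k] := ubnP #|~: ptransf_im a|; elim: k => // k IHk in a *; rewrite ltnS => leak.
have [aT|[p]] := set_0Vmem (~: ptransf_im a).
  have [|s ->] := @onto_of_perm a; last exact: Nperm.
  by rewrite -[ptransf_im a]setCK aT setC0.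
rewrite inE => pNa.
have Nassign i : ~~ isSome (a i) || [exists j, (i != j) && (a i == a j)] ->
    assign a i p \in N.
  move=> ai; apply: IHk; apply: leq_trans leak; apply: proper_card.
  rewrite properE; apply/andP; split; last first.
    apply/subsetPn; exists p; rewrite !inE in pNa *; rewrite // negbK.
    by apply/existsP; exists i; rewrite ffunE eqxx.
  rewrite setCS; apply/subsetP => q /ptransf_imP[u au]; apply/ptransf_imP.
  have [ui|ne] := eqVneq u i; last by exists u; rewrite ffunE (negPf ne).
  (* The value lost at [i] is still taken at [j]. *)
  move: ai; rewrite -ui au /= => /existsP[j /andP[ne /eqP aj]].
  by exists j; rewrite ffunE eq_sym (negPf ne) -aj.
have [[i ai]|[i [j [ne aij]]]] := not_onto_reducible pNa.
  by rewrite -(remove_assign p ai) NM // Nassign ?ai.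
rewrite -(collapse_assign p ne aij) NM ?NcolA // Nassign //.
by apply/orP; right; apply/existsP; exists j; rewrite ne aij /=.
Qed.

End PartialTransformationMonoid.

(* Identifies partial transformations of the leaves with the partial
   transformations of the star that fix the centre and send leaves to leaves. *)
Definition on_leaves n (a : ptransf 'I_n) : ptransf 'I_n.+1 :=
  [ffun u => if unlift ord0 u is Some k then omap (lift ord0) (a k)
             else Some ord0].

(** * Embedding the partial transformations of the leaves *)

Section OnLeaves.

Variable n : nat.
Implicit Types a b : ptransf 'I_n.

Lemma on_leaves0 a : on_leaves a ord0 = Some ord0.
Proof. by rewrite ffunE unlift_none. Qed.

Lemma on_leaves_lift a k :
  on_leaves a (lift ord0 k) = omap (lift ord0) (a k).
Proof. by rewrite ffunE liftK. Qed.

Lemma on_leavesM a b : on_leaves (a * b) = on_leaves a * on_leaves b.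
Proof.
apply/ffunP => u; rewrite ptransfME.
case: (unliftP ord0 u) => [k|] ->; last by rewrite !on_leaves0 /= on_leaves0.
rewrite !on_leaves_lift ptransfME; case: (a k) => //= x.
by rewrite on_leaves_lift.
Qed.

Lemma on_leaves1 : on_leaves (1 : ptransf 'I_n) = 1.
Proof.
apply/ffunP => u; rewrite ptransf1E.
case: (unliftP ord0 u) => [k|] ->; last by rewrite on_leaves0.
by rewrite on_leaves_lift ptransf1E.
Qed.

Lemma on_leavesP (x : ptransf 'I_n.+1) : x ord0 = Some ord0 ->
  (forall u, u != ord0 -> x u != Some ord0) -> exists a, x = on_leaves a.
Proof.
move=> x0 xl; exists [ffun k => obind (unlift ord0) (x (lift ord0 k))].
apply/ffunP => u.
case: (unliftP ord0 u) => [k|] ->; last by rewrite on_leaves0.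
rewrite on_leaves_lift ffunE.
have := xl (lift ord0 k) isT; case: (x _) => //= y.
by case: (unliftP ord0 y) => [j|] -> //= _; rewrite liftK.
Qed.

End OnLeaves.

(** * Partial strong weak endomorphisms of the star *)

Section Star.

Variable n : nat.
Local Notation V := 'I_n.+1.
Local Notation M := (PswEnd (star_graph n.+1)).
Implicit Types (x y : ptransf V) (u v w : V).

Lemma star_edgeE u v :
  star_graph n.+1 u v = (u == ord0) (+) (v == ord0).
Proof.
rewrite /= /star_edge -!(inj_eq val_inj) /=.
by case: (val u) => [|?]; case: (val v) => [|?].
Qed.

Lemma star_pswP x :
  reflect (forall u v p q, x u = Some p -> x v = Some q ->
    ((u == ord0) (+) (v == ord0)) && (p != q) = (p == ord0) (+) (q == ord0))
  (x \in M).
Proof.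
rewrite inE; apply: (iffP 'forall_forallP) => [H u v p q xu xv|H u v].
  by move/(_ u v): H; rewrite xu xv !star_edgeE => /eqP.
by have := H u v; case: (x u) (x v) => [p|] // [q|] // /(_ _ _ erefl erefl);
   rewrite !star_edgeE => ->.
Qed.

Lemma on_leaves_psw (a : ptransf 'I_n) : on_leaves a \in M.
Proof.
apply/star_pswP => u v p q.
case: (unliftP ord0 u) => [k|] ->; case: (unliftP ord0 v) => [l|] ->;
  rewrite ?on_leaves0 ?on_leaves_lift.
- by case: (a k) (a l) => [?|] // [?|] //= [<-] [<-].
- by case: (a k) => [?|] //= [<-] [<-].
- by case: (a l) => [?|] //= [<-] [<-].
- by move=> [<-] [<-].
Qed.

Lemma remove_psw v : remove v \in M.
Proof.
apply/star_pswP => u w p q; rewrite !ffunE.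
case: eqP => // _ [<-]; case: eqP => // _ [<-].
by have [->|_] := eqVneq u w; rewrite ?andbT // andbF addbb.
Qed.

Lemma psw_leaf_adj x u p q : x \in M -> u != ord0 ->
  x ord0 = Some p -> x u = Some q -> p != q -> (p == ord0) (+) (q == ord0).
Proof.
by move=> /star_pswP xM u0 x0 xu; rewrite -(xM _ _ _ _ x0 xu) (negPf u0).
Qed.

Lemma psw_leaf_nadj x u v p q : x \in M -> u != ord0 -> v != ord0 ->
  x u = Some p -> x v = Some q -> (p == ord0) = (q == ord0).
Proof.
move=> /star_pswP xM u0 v0 xu xv; have := xM _ _ _ _ xu xv.
by rewrite (negPf u0) (negPf v0) /=; case: (p == ord0); case: (q == ord0).
Qed.

(** Records which leaves lie in the domain of [x]. It fixes the centre even if [x] is undefined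
    there, so that it comes from a map of the leaves. *)
Definition restrict_leaves x : ptransf V :=
  on_leaves [ffun k => if x (lift ord0 k) then Some k else None].

Lemma restrict_leaves0 x : restrict_leaves x ord0 = Some ord0.
Proof. exact: on_leaves0. Qed.

Lemma restrict_leaves_leaf x u :
  u != ord0 -> restrict_leaves x u = if x u then Some u else None.
Proof.
case: (unliftP ord0 u) => [k|] -> // _.
by rewrite /restrict_leaves on_leaves_lift ffunE; case: (x _).
Qed.

End Star.

(** * Generation from the maps of the leaves and three further maps *)

Section Generation.

Variable n : nat.
Local Notation V := 'I_n.+2.
Local Notation M := (PswEnd (star_graph n.+2)).
Implicit Types (x y : ptransf V) (u v w : V).

Let leaf : V := lift ord0 ord0.

Definition to_centre : ptransf V := [ffun=> Some ord0].

Definition invert_star : ptransf V :=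
  [ffun u => Some (if u == ord0 then lift ord0 ord0 else ord0)].

Lemma to_centre_psw : to_centre \in M.
Proof.
by apply/star_pswP => u v p q; rewrite !ffunE => -[<-] [<-]; rewrite eqxx andbF.
Qed.

Lemma invert_star_psw : invert_star \in M.
Proof.
apply/star_pswP => u v p q; rewrite !ffunE => -[<-] [<-].
by case: (u == ord0); case: (v == ord0).
Qed.

(** The cases are: the centre outside the domain, fixed, or sent to a leaf. In each, the images of
    the leaves are so constrained that [x] factors explicitly. *)
Lemma star_gen (N : {set ptransf V}) : submonoid N ->
  (forall a, on_leaves a \in N) -> remove ord0 \in N ->
  to_centre \in N -> invert_star \in N -> M \subset N.
Proof.
move=> /submonoidP[_ NM] Nleaf Nrem Ncen Ninv; apply/subsetP => x xM.
have Nrestr : restrict_leaves x \in N by apply: Nleaf.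
case x0: (x ord0) => [i|]; last first.
  have [/exists_inP[u u0 /eqP xu]|/exists_inPn xl] :=
      boolP [exists u in [set~ ord0 : V], x u == Some ord0].
    (* Images of leaves are pairwise non-adjacent or equal, so once one leaf goes to the centre,
       every leaf in the domain does. *)
    suff -> : x = remove ord0 * (restrict_leaves x * to_centre) by rewrite !NM.
    apply/ffunP => v; rewrite !ptransfME ffunE.
    have [->|v0] := eqVneq v ord0; rewrite ?x0 //=.
    rewrite ptransfME restrict_leaves_leaf //; case xv: (x v) => [q|] //=.
    rewrite ffunE; rewrite !inE in u0; congr Some; apply/eqP.
    by rewrite -(psw_leaf_nadj xM u0 v0 xu xv).
  (* Otherwise defining [x] at the centre as the centre gives a map of the leaves, and [remove ord0]
     undoes this extension. *)
  have [a ax] : exists a, assign x ord0 ord0 = on_leaves a.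
    apply: on_leavesP => [|u u0]; rewrite ffunE ?eqxx // (negPf u0).
    by apply: xl; rewrite !inE.
  by rewrite -(remove_assign ord0 x0) NM // ax.
have [i0|i0] := eqVneq i ord0.
  rewrite {}i0 in x0.
  have [/exists_inP[u u0 /eqP xu]|/exists_inPn xl] :=
      boolP [exists u in [set~ ord0 : V], x u == Some ord0].
    suff -> : x = restrict_leaves x * to_centre by rewrite !NM.
    apply/ffunP => v; rewrite !ptransfME.
    have [->|v0] := eqVneq v ord0; first by rewrite restrict_leaves0 x0 /= ffunE.
    rewrite restrict_leaves_leaf //; case xv: (x v) => [q|] //=.
    rewrite ffunE; rewrite !inE in u0; congr Some; apply/eqP.
    by rewrite -(psw_leaf_nadj xM u0 v0 xu xv).
  have [u u0|a ->] := @on_leavesP _ x x0; last exact: Nleaf.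
  by apply: xl; rewrite !inE.
have [k ik] : exists k, i = lift ord0 k.
  by case: (unliftP ord0 i) i0 => [k|] -> //; exists k.
(* [invert_star] sends the centre to the first leaf only; this permutation moves that leaf on to
   [i]. *)
pose move_leaf := on_leaves (of_perm (tperm ord0 k)).
have moveE : move_leaf leaf = Some i.
  by rewrite /move_leaf on_leaves_lift ffunE tpermL ik.
have invE v : (invert_star * move_leaf) v = Some (if v == ord0 then i else ord0).
  by rewrite ptransfME ffunE /=; case: eqP => _; rewrite ?moveE // on_leaves0.
have Nim : invert_star * move_leaf \in N by rewrite NM // Nleaf.
have xleaf v q : v != ord0 -> x v = Some q -> q = i \/ q = ord0.
  move=> v0 xv; have [->|ne] := eqVneq q i; [by left | right; apply/eqP].
  by rewrite eq_sym in ne; have := psw_leaf_adj xM v0 x0 xv ne; rewrite (negPf i0).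
have [/exists_inP[u u0 /eqP xu]|/exists_inPn xl] :=
    boolP [exists u in [set~ ord0 : V], x u == Some i].
  (* Here every leaf in the domain goes to [i], so [x] is constant on its domain; in the remaining
     case they all go to the centre. *)
  suff -> : x = restrict_leaves x * to_centre * (invert_star * move_leaf).
    by rewrite NM // NM.
  apply/ffunP => v; rewrite ptransfME ptransfME.
  have [->|v0] := eqVneq v ord0.
    by rewrite restrict_leaves0 x0 /= ffunE /= invE.
  rewrite restrict_leaves_leaf //; case xv: (x v) => [q|] //=.
  rewrite ffunE /= invE eqxx; rewrite !inE in u0.
  case: (xleaf v q v0 xv) => qE; first by rewrite qE.
  by have := psw_leaf_nadj xM u0 v0 xu xv; rewrite (negPf i0) qE eqxx.
suff -> : x = restrict_leaves x * (invert_star * move_leaf) by rewrite NM.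
apply/ffunP => v; rewrite ptransfME.
have [->|v0] := eqVneq v ord0; first by rewrite restrict_leaves0 x0 /= invE.
rewrite restrict_leaves_leaf //; case xv: (x v) => [q|] //=.
rewrite invE (negPf v0); case: (xleaf v q v0 xv) => qE; last by rewrite qE.
by have := xl v; rewrite !inE v0 xv qE eqxx => /(_ isT).
Qed.

End Generation.

(** * Generating sets of finite monoids *)

(** The elements of [M] satisfying [Q] form a submonoid containing [A]. *)
Lemma monoid_gen_ind (T : finMonoidType) (A M : {set T}) (Q : pred T) :
  submonoid M -> monoid_gen A = M -> Q 1 -> {in A, forall x, Q x} ->
  {in M &, forall x y, Q x -> Q y -> Q (x * y)} -> {in M, forall x, Q x}.
Proof.
move=> /submonoidP[M1 MM] gA Q1 QA QM x; rewrite -{1}gA.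
have AM : A \subset M by rewrite -gA; apply/bigcapsP => N /andP[].
move/bigcapP/(_ [set x in M | Q x]); rewrite !inE => H.
suff /H/andP[] : submonoid [set x in M | Q x] && (A \subset [set x in M | Q x]) by [].
apply/andP; split.
  apply/submonoidP; split=> [|y z]; first by rewrite inE M1.
  by rewrite !inE => /andP[yM Qy] /andP[zM Qz]; rewrite MM ?QM.
by apply/subsetP => y Ay; rewrite inE (subsetP AM) ?QA.
Qed.

(** If no generator satisfied [P], the failure of [P] would spread to all products, hence to [x]. *)
Lemma monoid_gen_meets (T : finMonoidType) (A M : {set T}) (P : pred T) x :
  submonoid M -> monoid_gen A = M -> ~~ P 1 ->
  {in M &, forall y z, P (y * z) -> P y || P z} -> x \in M -> P x ->
  exists2 y, y \in A & P y.
Proof.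
move=> sM gA P1 PM xM Px; apply/exists_inP; apply: contraLR Px => /exists_inPn nP.
apply: (monoid_gen_ind (Q := fun y => ~~ P y) sM gA) xM => // y z yM zM Py Pz.
by apply: contra (PM _ _ yM zM) _; rewrite negb_or Py.
Qed.

(** If [A] had at most one element in [U], it would commute with every generator in [U]. As factors
    of an element of [U] lie in [U], one induction for each argument extends commutation to all of
    [U] in [M]. *)
Lemma two_generators (T : finMonoidType) (A M : {set T}) (U : pred T) x y :
  submonoid M -> monoid_gen A = M ->
  {in M &, forall z t, U (z * t) -> U z && U t} ->
  x \in M -> y \in M -> U x -> U y -> x * y != y * x ->
  exists z t, [/\ z \in A, t \in A, U z, U t & z != t].
Proof.
move=> sM gA UM xM yM Ux Uy nxy.
have [/exists_inP[z Az /exists_inP[t At /and3P[]]]|/exists_inPn H] :=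
  boolP [exists z in A, exists t in A, [&& U z, U t & z != t]].
  by exists z, t.
have AU z t : z \in A -> t \in A -> U z -> U t -> z = t.
  move=> Az At Uz Ut; have /exists_inPn/(_ t At) := H z Az.
  by rewrite Uz Ut /= negbK => /eqP.
have cA z : z \in A -> U z -> {in M, forall t, U t ==> (z * t == t * z)}.
  move=> Az Uz; apply: (monoid_gen_ind sM gA) => [|t At|t s tM sM' Ht Hs].
  - by rewrite mulg1 mul1g eqxx implybT.
  - by apply/implyP => Ut; rewrite (AU z t).
  apply/implyP => /(UM _ _ tM sM')/andP[Ut Us].
  by rewrite mulgA (eqP (implyP Ht Ut)) -!mulgA (eqP (implyP Hs Us)).
have cM : {in M, forall z, U z ==> [forall t in M, U t ==> (z * t == t * z)]}.
  apply: (monoid_gen_ind sM gA) => [|z Az|z s zM sM' Hz Hs].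
  - apply/implyP => _; apply/forall_inP => t _.
    by rewrite mulg1 mul1g eqxx implybT.
  - by apply/implyP => Uz; apply/forall_inP => t tM; apply: cA.
  apply/implyP => /(UM _ _ zM sM')/andP[Uz Us].
  apply/forall_inP => t tM; apply/implyP => Ut.
  move/implyP/(_ Uz)/forall_inP/(_ t tM)/implyP/(_ Ut)/eqP: Hz => zt.
  move/implyP/(_ Us)/forall_inP/(_ t tM)/implyP/(_ Ut)/eqP: Hs => st.
  by rewrite -mulgA st mulgA zt mulgA.
have := cM x xM; rewrite Ux => /forall_inP/(_ y yM).
by rewrite Uy (negPf nxy).
Qed.

(** * Classes that every generating set meets *)

Section IrreducibleClasses.

Variable m : nat.
Local Notation V := 'I_m.+4.
Local Notation M := (PswEnd (star_graph m.+4)).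
Implicit Types (x y : ptransf V) (u v w : V).

Definition total x := [forall u, isSome (x u)].

(** Nothing is asked of [x] at [w], so this covers both a map undefined at [w] and one that
    identifies [w] with another vertex. *)
Definition injective_off w x :=
  [forall u, (u != w) ==> isSome (x u)] &&
  [forall u, forall v, [&& u != w, v != w & x u == x v] ==> (u == v)].

Definition is_unit x := total x && injectiveb x.
Definition collapses_pair x :=
  [&& total x, ~~ injectiveb x & [exists w, injective_off w x]].
Definition omits_leaf x :=
  [exists w, [&& w != ord0, x w == None & injective_off w x]].
Definition omits_centre x := (x ord0 == None) && injective_off ord0 x.
Definition inverts_star x :=
  [exists p, (p != ord0) && (x ord0 == Some p)] && [exists u, x u == Some ord0].
Definition contracts_edge x :=
  [exists u, [&& u != ord0, isSome (x u) & x u == x ord0]].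

(** Holds for units and for the classes defined through [injective_off]; fails for endomorphisms in
    the last two classes. *)
Definition separates_leaves x :=
  [exists u, exists v,
    [&& u != ord0, v != ord0, isSome (x u), isSome (x v) & x u != x v]].

Lemma injective_offP w x :
  reflect ((forall u, u != w -> isSome (x u)) /\
           (forall u v, u != w -> v != w -> x u = x v -> u = v))
    (injective_off w x).
Proof.
apply: (iffP andP) => -[D I]; split.
- by move=> u; apply/implyP; apply: (forallP D).
- move=> u v uw vw xuv; apply/eqP; move/'forall_forallP/(_ u v)/implyP: I; apply.
  by rewrite uw vw xuv /=.
- by apply/forallP => u; apply/implyP/D.
by apply/'forall_forallP => u v; apply/implyP => /and3P[uw vw /eqP xuv];
   apply/eqP/I.
Qed.

Lemma is_unitP x : reflect ((forall u, isSome (x u)) /\ injective x) (is_unit x).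
Proof.
by apply: (iffP andP) => -[D I];
   by split; [apply/forallP | apply/injectiveP].
Qed.

Lemma unit_onto x v : is_unit x -> exists u, x u = Some v.
Proof.
case/is_unitP=> D I; pose f u := odflt u (x u).
have xE u : x u = Some (f u) by rewrite /f; case: (x u) (D u).
have f_inj : injective f by move=> u w fuw; apply: I; rewrite !xE fuw.
by have /codomP[u ->] : v \in codom f by [apply: injF_onto]; exists u.
Qed.

Lemma ptransfM_dom x y u : isSome ((x * y) u) -> isSome (x u).
Proof. by rewrite ptransfME; case: (x u). Qed.

(** The factor [x] inherits totality and injectivity, so it is onto by finiteness, and [y] can be
    tested at points [x u]. *)
Lemma is_unitM x y : is_unit (x * y) -> is_unit x && is_unit y.
Proof.
case/is_unitP=> D I; have Ux : is_unit x.
  apply/is_unitP; split=> [u|u v xuv]; first exact: ptransfM_dom (D u).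
  by apply: I; rewrite !ptransfME xuv.
rewrite Ux; apply/is_unitP; split=> [v|v w].
  by have [u xu] := unit_onto v Ux; have := D u; rewrite ptransfME xu.
have [u xu] := unit_onto v Ux; have [t xt] := unit_onto w Ux => yvw.
have /I ut : (x * y) u = (x * y) t by rewrite !ptransfME xu xt.
by move: xu; rewrite ut xt => -[].
Qed.

Lemma injective_off_mull w x y : injective_off w (x * y) -> injective_off w x.
Proof.
case/injective_offP=> D I; apply/injective_offP; split=> [u /D/ptransfM_dom //|].
by move=> u v uw vw xuv; apply: I; rewrite // !ptransfME xuv.
Qed.

Lemma injective_off_mulr w w' x y : is_unit x -> x w = Some w' ->
  injective_off w (x * y) -> injective_off w' y.
Proof.
move=> Ux xw /injective_offP[D I].
have ne u v : x u = Some v -> v != w' -> u != w.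
  by move=> xu; apply: contra => /eqP uw; move: xu; rewrite uw xw => -[->].
apply/injective_offP; split=> [v vw|v t vw tw yvt].
  have [u xu] := unit_onto v Ux.
  by have := D u (ne u v xu vw); rewrite ptransfME xu.
have [u xu] := unit_onto v Ux; have [s xs] := unit_onto t Ux.
have us : u = s.
  by apply: I; rewrite ?(ne _ _ xu) ?(ne _ _ xs) // !ptransfME xu xs.
by move: xu; rewrite us xs => -[].
Qed.

(** With at least four vertices there are three leaves 1, 2, 3, and at most one of them is [w]. *)
Lemma leaves_off w :
  exists u v, [/\ u != ord0, v != ord0, u != w, v != w & u != v].
Proof.
pose l (k : nat) : V := inord k.
have lE (k : nat) : k < 4 -> l k = k :> nat.
  by move=> k4; rewrite inordK // (leq_trans k4).
have lne (j k : nat) : j < 4 -> k < 4 -> j != k -> l j != l k.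
  by move=> j4 k4; apply: contraNneq => /(congr1 val) /=; rewrite !lE // => ->.
have l0 : ord0 = l 0 by apply/val_inj; rewrite /= lE.
rewrite l0; have [->|w1] := eqVneq w (l 1%N).
  by exists (l 2), (l 3); rewrite !lne.
have [->|w2] := eqVneq w (l 2); first by exists (l 1%N), (l 3); rewrite !lne.
by exists (l 1%N), (l 2); rewrite !lne // eq_sym w1 eq_sym.
Qed.

Lemma injective_off_separates w x : injective_off w x -> separates_leaves x.
Proof.
case/injective_offP=> D I; have [u [v [u0 v0 uw vw uv]]] := leaves_off w.
apply/existsP; exists u; apply/existsP; exists v; rewrite u0 v0 !D //=.
by apply: contra uv => /eqP xuv; apply/eqP/I.
Qed.

Lemma is_unit_injective_off w x : is_unit x -> injective_off w x.
Proof. by case/is_unitP=> D I; apply/injective_offP; split=> // u v _ _ /I. Qed.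

Lemma psw_values x u p q : x \in M -> u != ord0 ->
  x ord0 = Some p -> x u = Some q -> p = q \/ (p == ord0) (+) (q == ord0).
Proof.
move=> xM u0 x0 xu; have [->|ne] := eqVneq p q; [by left | right].
exact: psw_leaf_adj xM u0 x0 xu ne.
Qed.

(** Distinct images of two leaves are non-adjacent, so both are leaves. The image of the centre, if
    any, equals or is adjacent to each of them, so it is the centre; no leaf can go there as
    well. *)
Lemma separates_psw x : x \in M -> separates_leaves x ->
  (x ord0 = None \/ x ord0 = Some ord0) /\ ~~ contracts_edge x.
Proof.
move=> xM /existsP[u /existsP[v /and5P[u0 v0]]].
case xu: (x u) => [p|] // _; case xv: (x v) => [q|] // _ ne.
have pq := psw_leaf_nadj xM u0 v0 xu xv.
have p0 : p != ord0.
  by apply: contra ne => p0; move: pq; rewrite p0 (eqP p0) => /esym/eqP->.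
have q0 : q != ord0 by rewrite -pq.
have x0 : x ord0 = None \/ x ord0 = Some ord0.
  case x0: (x ord0) => [i|]; [right | by left].
  case: (psw_values xM u0 x0 xu) => [ip|]; last first.
    by rewrite (negPf p0) addbF => /eqP->.
  case: (psw_values xM v0 x0 xv) => [iq|].
    by rewrite -ip iq eqxx in ne.
  by rewrite (negPf q0) addbF => /eqP->.
split=> //; apply/existsPn => w; apply/negP => /and3P[w0 Sw].
case: x0 => x0; rewrite x0; first by move/eqP => xw; rewrite xw in Sw.
by move/eqP/(psw_leaf_nadj xM u0 w0 xu); rewrite eqxx (negPf p0).
Qed.

Lemma is_unit0 x : x \in M -> is_unit x -> x ord0 = Some ord0.
Proof.
move=> xM Ux; have /separates_psw[|[x0|//] _] := injective_off_separates
  (is_unit_injective_off ord0 Ux) => //.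
by case/is_unitP: Ux => /(_ ord0); rewrite x0.
Qed.

Lemma collapses_pairM :
  {in M &, forall x y,
    collapses_pair (x * y) -> collapses_pair x || collapses_pair y}.
Proof.
move=> x y xM yM /and3P[/forallP D nI /existsP[w Iw]].
have Dx u : isSome (x u) := ptransfM_dom (D u).
(* If [x] is not injective, it collapses the pair itself; otherwise it is a unit and only relabels
   the vertices for [y]. *)
have [Ix|nIx] := boolP (injectiveb x); last first.
  apply/orP; left; apply/and3P; split=> //; first exact/forallP.
  by apply/existsP; exists w; apply: injective_off_mull Iw.
have Ux : is_unit x by apply/andP; split=> //; apply/forallP.
case xw: (x w) (Dx w) => [w'|] // _.
apply/orP; right; apply/and3P; split.
- apply/forallP => v; have [u xu] := unit_onto v Ux.
  by have := D u; rewrite ptransfME xu.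
- apply: contra nI => /injectiveP Iy; apply/injectiveP => u v.
  have /injectiveP Ix' := Ix; rewrite !ptransfME.
  case xu: (x u) (Dx u) => [p|] // _; case xv: (x v) (Dx v) => [q|] // _ /= /Iy pq.
  by apply: Ix'; rewrite xu xv pq.
by apply/existsP; exists w'; apply: injective_off_mulr Ux xw Iw.
Qed.

(* If [w] is the only vertex outside the domain of [x * y], then [x] cannot
   identify [w] with another vertex. *)
Lemma omitsM w x y : (x * y) w = None -> injective_off w (x * y) ->
  x w = None \/
  is_unit x /\ exists w', [/\ x w = Some w', y w' = None & injective_off w' y].
Proof.
move=> xyw Iw; case xw: (x w) => [w'|]; [right | by left].
have [Dx Ix] := injective_offP _ _ (injective_off_mull Iw).
have [D _] := injective_offP _ _ Iw.
have Ux : is_unit x.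
  have xuw u : u != w -> x u != x w.
    move=> uw; apply/eqP => xuw; have := D u uw.
    by rewrite ptransfME xuw -ptransfME xyw.
  apply/is_unitP; split=> [u|u v xuv].
    by have [->|/Dx //] := eqVneq u w; rewrite xw.
  have [uw|uw] := eqVneq u w; have [vw|vw] := eqVneq v w; rewrite ?uw ?vw //.
  - by have := xuw v vw; rewrite -xuv uw eqxx.
  - by have := xuw u uw; rewrite xuv vw eqxx.
  exact: Ix.
split=> //; exists w'; split=> //; last exact: injective_off_mulr Ux xw Iw.
by move: xyw; rewrite ptransfME xw.
Qed.

Lemma omits_leafM :
  {in M &, forall x y, omits_leaf (x * y) -> omits_leaf x || omits_leaf y}.
Proof.
move=> x y xM yM /existsP[w /and3P[w0 /eqP xyw Iw]].
have [xw|[Ux [w' [xw yw Iy]]]] := omitsM xyw Iw.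
  apply/orP; left; apply/existsP; exists w; rewrite w0 xw eqxx.
  exact: injective_off_mull Iw.
apply/orP; right; apply/existsP; exists w'; rewrite yw eqxx Iy !andbT.
(* The unit [x] fixes the centre, so it cannot send the leaf [w] there. *)
apply: contra w0 => /eqP w'0; apply/eqP.
by have [_] := is_unitP _ Ux; apply; rewrite xw w'0 is_unit0.
Qed.

Lemma omits_centreM :
  {in M &, forall x y,
    omits_centre (x * y) -> omits_centre x || omits_centre y}.
Proof.
move=> x y xM yM /andP[/eqP xyw Iw].
have [xw|[Ux [w' [xw yw Iy]]]] := omitsM xyw Iw; rewrite /omits_centre.
  by rewrite xw eqxx (injective_off_mull Iw).
move: xw yw Iy; rewrite is_unit0 // => -[<-] -> ->.
by rewrite eqxx orbT.
Qed.

(** If [x] fixes the centre, [y] inverts. Otherwise [x] sends the centre to a leaf [i]; the image of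
    [u] under [x] differs from [i], since [y] separates them, so it is adjacent to [i] and is the
    centre. *)
Lemma inverts_starM :
  {in M &, forall x y,
    inverts_star (x * y) -> inverts_star x || inverts_star y}.
Proof.
move=> x y xM yM /andP[/existsP[p /andP[p0]] /[swap] /existsP[u]].
rewrite !ptransfME; case xu: (x u) => [q|] //= /eqP yq.
case x0: (x ord0) => [i|] //= /eqP yi.
have [i0|i0] := eqVneq i ord0.
  apply/orP; right; apply/andP; split; apply/existsP; last by exists q; apply/eqP.
  by exists p; rewrite p0 -i0 yi /=.
apply/orP; left; apply/andP; split; apply/existsP.
  by exists i; rewrite i0 x0 /=.
have u0 : u != ord0.
  apply: contra p0 => /eqP u0; move: xu; rewrite u0 x0 => -[iq].
  by move: yi; rewrite iq yq => -[<-].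
exists u; rewrite xu; case: (psw_values xM u0 x0 xu) => [iq|].
  by move: yi p0; rewrite iq yq => -[<-]; rewrite eqxx.
by rewrite (negPf i0) => /= /eqP->.
Qed.

(** Either [x] identifies [u] with the centre, or it maps them to adjacent vertices, one of which is
    the centre, and [y] identifies these. *)
Lemma contracts_edgeM :
  {in M &, forall x y,
    contracts_edge (x * y) -> contracts_edge x || contracts_edge y}.
Proof.
move=> x y xM yM /existsP[u /and3P[u0]].
rewrite !ptransfME; case xu: (x u) => [q|] //= Sq.
case x0: (x ord0) => [i|] /= yqi; last by rewrite (eqP yqi) in Sq.
have [iq|] := psw_values xM u0 x0 xu.
  by apply/orP; left; apply/existsP; exists u; rewrite u0 xu x0 iq /=.
move=> iq; apply/orP; right; apply/existsP.
have [i0|i0] := eqVneq i ord0.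
  have q0 : q != ord0 by move: iq; rewrite i0 eqxx.
  by exists q; rewrite q0 Sq -i0 yqi.
rewrite (negPf i0) /= in iq; rewrite (eqP iq) in yqi Sq.
by exists i; rewrite i0 -(eqP yqi) Sq eqxx.
Qed.

(** * An invariant distinguishing the classes *)

(** One number tells the units and the five classes apart, so that disjointness reduces to distinct
    values; on other maps the value has no meaning. *)
Definition class x : nat :=
  if ~~ separates_leaves x then (if contracts_edge x then 6 else 5)
  else if total x then (if injectiveb x then 1%N else 2)
  else if x ord0 == None then 4 else 3.

Lemma class_unit x : is_unit x -> class x = 1%N.
Proof.
move=> Ux; rewrite /class (injective_off_separates (is_unit_injective_off ord0 Ux)).
by case/andP: Ux => -> ->.
Qed.

Lemma class_collapses_pair x : collapses_pair x -> class x = 2.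
Proof.
case/and3P=> tx nI /existsP[w Iw].
by rewrite /class (injective_off_separates Iw) tx (negPf nI).
Qed.

Lemma class_omits_leaf x : omits_leaf x -> class x = 3.
Proof.
case/existsP=> w /and3P[w0 /eqP xw Iw]; rewrite /class (injective_off_separates Iw).
have -> : total x = false by apply/negP => /forallP/(_ w); rewrite xw.
have [D _] := injective_offP _ _ Iw.
by have := D ord0; rewrite eq_sym => /(_ w0); case: (x ord0).
Qed.

Lemma class_omits_centre x : omits_centre x -> class x = 4.
Proof.
case/andP=> /eqP x0 Iw; rewrite /class (injective_off_separates Iw) x0 eqxx.
by have -> : total x = false by apply/negP => /forallP/(_ ord0); rewrite x0.
Qed.

Lemma class_inverts_star x : x \in M -> inverts_star x -> class x = 5.
Proof.
move=> xM /andP[/existsP[p /andP[p0 /eqP x0]] /existsP[u /eqP xu]]; rewrite /class.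
have -> /= : ~~ separates_leaves x.
  apply/negP => /(separates_psw xM)[]; rewrite x0; case=> // -[pE].
  by rewrite pE eqxx in p0.
have u0 : u != ord0.
  by apply: contraNneq p0 => u0; move: xu; rewrite u0 x0 => -[->].
suff /negbTE-> : ~~ contracts_edge x by [].
(* A leaf [v] sharing the leaf image of the centre would have an image adjacent to that of [u]. *)
apply/existsPn => v; apply/negP => /and3P[v0 _ /eqP xv].
have := psw_leaf_nadj xM u0 v0 xu (etrans xv x0).
by rewrite eqxx (negPf p0).
Qed.

Lemma class_contracts_edge x : x \in M -> contracts_edge x -> class x = 6.
Proof.
move=> xM cx; rewrite /class ifT ?cx //.
by apply/negP => /(separates_psw xM)[_]; rewrite cx.
Qed.

End IrreducibleClasses.

(** * Seven generators, and the lower bound *)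

Section StarRank.

Variable m : nat.
Local Notation V := 'I_m.+4.
Local Notation M := (PswEnd (star_graph m.+4)).
Local Notation leaf_perm s := (on_leaves (of_perm (s : 'S_m.+3))).

Let l1 : 'I_m.+3 := inord 1.
Let l2 : 'I_m.+3 := inord 2.

Let l01 : ord0 != l1.
Proof. by apply/eqP => /(congr1 val); rewrite /= inordK. Qed.

Let l02 : ord0 != l2.
Proof. by apply/eqP => /(congr1 val); rewrite /= inordK. Qed.

Let l12 : l1 != l2.
Proof. by apply/eqP => /(congr1 val); rewrite /= !inordK. Qed.

Definition star_generators : seq (ptransf V) :=
  [:: leaf_perm (tperm ord0 (inord 1)); leaf_perm (perm (@ordS_inj m.+3));
      on_leaves (collapse ord0 (inord 1)); on_leaves (remove ord0); remove ord0;
      invert_star m.+2; to_centre m.+2].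

Lemma star_generators_gen : monoid_gen [set:: star_generators] = M.
Proof.
apply/eqP; rewrite eqEsubset; apply/andP; split.
  apply: bigcap_inf; rewrite PswEnd_submonoid; apply/subsetP => x.
  rewrite in_set !in_cons in_nil orbF => /or4P[|||/or4P[]] /eqP->;
    by rewrite ?on_leaves_psw ?remove_psw ?invert_star_psw ?to_centre_psw.
apply/bigcapsP => N /andP[/[dup] sN /submonoidP[N1 NM] /subsetP gN].
have Ng x : x \in star_generators -> x \in N by move=> gx; apply: gN; rewrite inE.
apply: star_gen => //; try by apply: Ng; rewrite !inE eqxx ?orbT.
(* The preimage of [N] under [on_leaves] is a submonoid, so the generators of the partial
   transformations of the leaves suffice. *)
suff NT : [set a : ptransf 'I_m.+3 | on_leaves a \in N] = setT.
  by move=> a; have := in_setT a; rewrite -NT inE.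
apply: (@ptransf_gen _ _ ord0 l1) => // [|s||]; rewrite ?inE;
  try by apply: Ng; rewrite !inE eqxx ?orbT.
  apply/submonoidP; split=> [|a b]; rewrite !inE ?on_leaves1 //.
  by rewrite on_leavesM; apply: NM.
(* In a finite group, closure under products already gives a subgroup, so the two permutations yield
   all of them. *)
have gP : group_set [set s : 'S_m.+3 | leaf_perm s \in N].
  apply/group_setP; split=> [|t r]; rewrite !inE ?of_perm1 ?on_leaves1 //.
  by rewrite of_permM on_leavesM; apply: NM.
suff : [set: 'S_m.+3] \subset Group gP by move/subsetP/(_ s); rewrite !inE; apply.
rewrite -perm_gen_tperm_ordS gen_subG; apply/subsetP => t.
by rewrite !inE => /orP[] /eqP->; apply: Ng; rewrite !inE eqxx ?orbT.
Qed.

Lemma leaf_perm_unit s : is_unit (leaf_perm s).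
Proof.
apply/is_unitP; split=> [u|u v].
  case: (unliftP ord0 u) => [k|] ->; last by rewrite on_leaves0.
  by rewrite on_leaves_lift ffunE.
case: (unliftP ord0 u) => [k|] ->; case: (unliftP ord0 v) => [l|] ->;
  rewrite ?on_leaves0 ?on_leaves_lift ?ffunE //=.
by move=> /Some_inj/lift_inj/perm_inj->.
Qed.

Lemma collapse_collapses_pair :
  collapses_pair (on_leaves (collapse ord0 (inord 1)) : ptransf V).
Proof.
apply/and3P; split.
- apply/forallP => u.
  case: (unliftP ord0 u) => [k|] ->; last by rewrite on_leaves0.
  by rewrite on_leaves_lift ffunE.
- apply/injectivePn; exists (lift ord0 ord0), (lift ord0 l1).
    by rewrite (inj_eq lift_inj).
  by rewrite !on_leaves_lift !ffunE /= if_same.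
apply/existsP; exists (lift ord0 ord0); apply/injective_offP; split=> [u|u v].
  case: (unliftP ord0 u) => [k|] ->; last by rewrite on_leaves0.
  by rewrite on_leaves_lift ffunE.
case: (unliftP ord0 u) => [k|] ->; case: (unliftP ord0 v) => [l|] ->;
  rewrite ?on_leaves0 ?on_leaves_lift ?ffunE //=.
rewrite !(inj_eq lift_inj) => /negPf-> /negPf->.
by move=> /Some_inj/lift_inj->.
Qed.

Lemma remove_leaf_omits_leaf : omits_leaf (on_leaves (remove ord0) : ptransf V).
Proof.
apply/existsP; exists (lift ord0 ord0); rewrite on_leaves_lift ffunE eqxx /=.
apply/injective_offP; split=> [u|u v].
  case: (unliftP ord0 u) => [k|] ->; last by rewrite on_leaves0.
  by rewrite on_leaves_lift ffunE (inj_eq lift_inj) => /negPf->.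
case: (unliftP ord0 u) => [k|] ->; case: (unliftP ord0 v) => [l|] ->;
  rewrite ?on_leaves0 ?on_leaves_lift ?ffunE ?(inj_eq lift_inj) //=.
- by move=> /negPf-> /negPf-> /= /Some_inj/lift_inj->.
- by move=> /negPf->.
by move=> _ /negPf->.
Qed.

Lemma remove_centre_omits_centre : omits_centre (remove ord0 : ptransf V).
Proof.
rewrite /omits_centre ffunE eqxx; apply/injective_offP; split=> [u|u v].
  by rewrite ffunE => /negPf->.
by rewrite !ffunE => /negPf-> /negPf-> [].
Qed.

Lemma invert_star_inverts : inverts_star (invert_star m.+2).
Proof.
by apply/andP; split; apply/existsP; exists (lift ord0 ord0); rewrite !ffunE.
Qed.

Lemma to_centre_contracts : contracts_edge (to_centre m.+2).
Proof. by apply/existsP; exists (lift ord0 ord0); rewrite !ffunE. Qed.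

Lemma star_rank_lower (A : {set ptransf V}) : monoid_gen A = M -> 7 <= #|A|.
Proof.
move=> gA; have sM := PswEnd_submonoid (star_graph m.+4).
have AM : A \subset M by rewrite -gA; apply/bigcapsP => N /andP[].
have U1 : is_unit (1 : ptransf V).
  by rewrite -on_leaves1 -of_perm1 leaf_perm_unit.
have c1 : class (1 : ptransf V) = 1%N := class_unit U1.
have M1 : (1 : ptransf V) \in M by case/submonoidP: sM.
have [|u [v [Au Av Uu Uv uv]]] := @two_generators _ A M (@is_unit m)
    (leaf_perm (tperm ord0 l1)) (leaf_perm (tperm l1 l2)) sM gA
    (in2W (@is_unitM m)) (on_leaves_psw _) (on_leaves_psw _)
    (leaf_perm_unit _) (leaf_perm_unit _).
  (* The two products differ at the first leaf, which they send to the leaves of [l2] and [l1]. *)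
  rewrite -!on_leavesM -!of_permM; apply/eqP.
  move/ffunP/(_ (lift ord0 ord0)); rewrite !on_leaves_lift !ffunE !permM /=.
  rewrite tpermL tpermL (tpermD (x := l1)) 1?eq_sym // tpermL.
  by move=> /Some_inj/lift_inj/eqP; rewrite eq_sym (negPf l12).
have [|b Ab Cb] := monoid_gen_meets sM gA _ (@collapses_pairM m)
    (on_leaves_psw _) collapse_collapses_pair.
  by apply/negP => /class_collapses_pair; rewrite c1.
have [|c Ac Cc] := monoid_gen_meets sM gA _ (@omits_leafM m)
    (on_leaves_psw _) remove_leaf_omits_leaf.
  by apply/negP => /class_omits_leaf; rewrite c1.
have [|d Ad Cd] := monoid_gen_meets sM gA _ (@omits_centreM m)
    (remove_psw _) remove_centre_omits_centre.
  by apply/negP => /class_omits_centre; rewrite c1.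
have [|e Ae Ce] := monoid_gen_meets sM gA _ (@inverts_starM m)
    (invert_star_psw _) invert_star_inverts.
  by apply/negP => /(class_inverts_star M1); rewrite c1.
have [|f Af Cf] := monoid_gen_meets sM gA _ (@contracts_edgeM m)
    (to_centre_psw _) to_centre_contracts.
  by apply/negP => /(class_contracts_edge M1); rewrite c1.
pose s := [:: u; v; b; c; d; e; f].
have sA : {subset s <= enum A}.
  by apply/allP; rewrite /= !mem_enum Au Av Ab Ac Ad Ae Af.
rewrite cardE; apply: (@leq_trans (size s)) => //; apply: uniq_leq_size sA.
(* The units [u] and [v] share the value 1 and are distinct by [uv]; all other repetitions are
   excluded by [class]. *)
rewrite /s cons_uniq; apply/andP; split; last first.
  apply: (@map_uniq _ _ (@class m)) => /=.
  rewrite (class_unit Uv) (class_collapses_pair Cb) (class_omits_leaf Cc).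
  rewrite (class_omits_centre Cd) (class_inverts_star (subsetP AM _ Ae) Ce).
  by rewrite (class_contracts_edge (subsetP AM _ Af) Cf).
rewrite inE negb_or uv /=; apply/negP => /(map_f (@class m)) /=.
rewrite (class_unit Uu) (class_collapses_pair Cb) (class_omits_leaf Cc).
rewrite (class_omits_centre Cd) (class_inverts_star (subsetP AM _ Ae) Ce).
by rewrite (class_contracts_edge (subsetP AM _ Af) Cf).
Qed.

End StarRank.

Theorem theorem3p4 (n : nat) (hn : 4 <= n) :
  monoid_rank (PswEnd (star_graph n)) = 7.
Proof.
case: n hn => [|[|[|[|m]]]] // _.
apply/monoid_rankP; first exact: PswEnd_submonoid.
split; last exact: star_rank_lower.
have gA := star_generators_gen m.
(* The list has seven entries, so its set has at most seven elements; the lower bound shows that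
   they are distinct. *)
exists [set:: star_generators m] => //; apply/eqP; rewrite eqn_leq.
by rewrite star_rank_lower // andbT cardsE card_size.
Qed.
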